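(* Let $G$ be a graph with $n$ vertices, let $\Gamma_n$ be an $n$-leaf caterpillar with no vertices of degree $2$, and let $\Pi_n$ be the $n$-leaf reduced centipede. If $G=PCG(\Gamma_n,w,d_{min},d_{max})$, then there exist a positive edge-weight function $w'$ on the edges of $\Pi_n$ and a real number $d'_{max}\ge d_{min}$ such that $G=PCG(\Pi_n,w',d_{min},d'_{max})$.
   Context: A graph $G=(V,E)$ is $PCG(T,w,d_{min},d_{max})$ if $T$ is a tree, $w$ assigns positive real weights to the edges of $T$, $d_{min}\le d_{max}$ are non-negative reals, each vertex $u\in V$ is associated bijectively to a leaf $l_u$ of $T$, and for all distinct $u,v\in V$, $(u,v)\in E$ if and only if $d_{min}\le d_{T,w}(l_u,l_v)\le d_{max}$, where $d_{T,w}(l_u,l_v)$ is the sum of the weights of the edges on the path from $l_u$ to $l_v$ in $T$. A caterpillar $\Gamma_n$ is an $n$-leaf tree in which every leaf is at distance exactly one from a central path (the spine). A centipede is an $n$-leaf caterpillar whose spine is a path $s_1,\dots,s_n$ with exactly one leaf attached to each $s_i$ (so the leaf edges form a perfect matching). The reduced centipede $\Pi_n$ is obtained from the $n$-leaf centipede by deleting each vertex of degree two and merging its two incident edges into a single edge; equivalently, $\Pi_n$ has spine path $t_2,\dots,t_{n-1}$, leaves $m_1,\dots,m_n$, with $m_i$ adjacent to $t_i$ for $2\le i\le n-1$, $m_1$ adjacent to $t_2$ and $m_n$ adjacent to $t_{n-1}$. *)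

(* Defs.v *)
From HB Require Import structures.
From mathcomp Require Import all_boot all_order all_algebra.
From mathcomp Require Import classical_sets reals.

Set Implicit Arguments.
Unset Strict Implicit.
Unset Printing Implicit Defensive.

Import Order.TTheory GRing.Theory Num.Theory.

Local Open Scope ring_scope.

Record sgraph := SGraph {
  svertex :> finType;
  sedge : rel svertex;
  sedge_sym : symmetric sedge;
  sedge_irrefl : irreflexive sedge
}.

Arguments sedge {s} x y.

Section Trees.
Variable T : sgraph.
Implicit Types (x y : T) (p : seq T).

Definition degree x : nat := #|[set y | sedge x y]|.

Definition is_leaf x : bool := degree x == 1%N.

Definition is_tree : Prop :=
  [/\ (0 < #|T|)%N,
      forall x y, connect sedge x y
    & forall p, (2 < size p)%N -> ~ ucycle sedge p].

(* As in [path], the start [x] is given separately from the rest [p]. *)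
Definition simple_path x y p : bool :=
  [&& path sedge x p, uniq (x :: p) & last x p == y].

(* In a tree the simple path exists and is unique; [::] is the junk value of
   [xget] for disconnected vertices. *)
Definition tree_path x y : seq T :=
  xget [::] [set p | simple_path x y p]%classic.

(* A caterpillar may have several spines, so the spine [x :: p] is quantified
   existentially. It is nonempty, possibly a single vertex (a star). Being at
   distance exactly one from the spine means lying off it and being adjacent to
   one of its vertices. *)
Definition is_caterpillar (n : nat) : Prop :=
  [/\ is_tree, #|[set x | is_leaf x]| = n
    & exists x p,
        [/\ path sedge x p, uniq (x :: p)
          & forall y, is_leaf y ->
              y \notin x :: p /\ exists2 z, z \in x :: p & sedge y z]].

Variable R : realType.

(* A weight function is defined on unordered pairs [set x; y]; only its values
   on edges matter. *)
Definition positive_weight (w : {set T} -> R) : Prop :=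
  forall x y, sedge x y -> 0 < w [set x; y].

Definition wdist (w : {set T} -> R) x y : R :=
  \sum_(c <- pairmap (fun a b => w [set a; b]) x (tree_path x y)) c.

End Trees.

Definition is_PCG (R : realType) (G T : sgraph) (w : {set T} -> R)
    (dmin dmax : R) : Prop :=
  [/\ is_tree T, positive_weight w, 0 <= dmin, dmin <= dmax
    & exists2 l : G -> {x : T | is_leaf x}, bijective l
    & forall u v : G, u != v ->
        sedge u v <-> dmin <= wdist w (val (l u)) (val (l v)) <= dmax].

(* Vertices of the reduced centipede with n leaves: for n >= 3, [inl i] is the
   leaf m_(i+1) (0 <= i < n) and [inr j] is the spine vertex t_(j+2)
   (0 <= j <= n - 3). The values for n < 3 are a matter of convention: no tree
   without vertices of degree 2 is a caterpillar with 1 or 2 leaves, and for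
   n = 0 one gets the one-vertex tree. *)
Definition rc_vertex (n : nat) : finType := ('I_n + 'I_(n - 3).+1)%type.

(* m_(i+1) is adjacent to t_(j+2): the clauses are m_k -- t_k for
   2 <= k <= n - 1, then m_1 -- t_2, then m_n -- t_(n-1). *)
Definition rc_leg (n : nat) (i : 'I_n) (j : 'I_(n - 3).+1) : bool :=
  [|| i == j.+1 :> nat,
      (i == 0 :> nat) && (j == 0 :> nat)
    | (i.+1 == n) && (j.+3 == n)].

Definition rc_edge (n : nat) : rel (rc_vertex n) := fun x y =>
  match x, y with
  | inl i, inr j => rc_leg i j
  | inr j, inl i => rc_leg i j
  | inr j, inr k => (j.+1 == k :> nat) || (k.+1 == j :> nat)
  | inl _, inl _ => false
  end.

Lemma rc_edge_sym (n : nat) : symmetric (@rc_edge n).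
Proof. by case=> [i|j] [i'|j'] //=; rewrite orbC. Qed.

Lemma rc_edge_irrefl (n : nat) : irreflexive (@rc_edge n).
Proof. by case=> [i|j] //=; rewrite orbb eqn_leq ltnn. Qed.

Definition reduced_centipede (n : nat) : sgraph :=
  SGraph (@rc_edge_sym n) (@rc_edge_irrefl n).

(* Main.v *)
(** A leaf of the caterpillar is described by the length [H] of its leg and by
    the position [A] of its foot along the spine, and two leaves are at distance
    [H u + H v + |A v - A u|].  Number the leaves by increasing position and move
    the foot of the [i]-th one to [A + eps * i].  The positions are then strictly
    increasing, so they are realized by positive weights on the reduced
    centipede, the two extreme legs absorbing the outer portions of the spine.
    Distances only grow, by less than a quantity [e] which we choose smaller than
    every gap [dmin - d] or [d - dmax] between a distance [d] outside
    [[dmin, dmax]] and that interval; hence [dmin] can be kept and [dmax] is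
    replaced with [dmax + e]. *)
Require Import Defs.
From HB Require Import structures.
From mathcomp Require Import all_boot all_order all_algebra.
From mathcomp Require Import classical_sets reals.
From mathcomp Require Import zify ring lra.

Set Implicit Arguments.
Unset Strict Implicit.
Unset Printing Implicit Defensive.

Import Order.TTheory GRing.Theory Num.Theory.

Local Open Scope ring_scope.

(** * Simple paths and distances in a tree *)

Section SimplePaths.
Variable T : sgraph.
Implicit Types (x y : T) (p q : seq T).

(** Cut [p] at its first vertex lying on [q], and return to [x] along [q]. As the paths leave [x] by
    different vertices, at least one of the two pieces has an inner vertex, so the cycle has length
    at least 3. *)
Lemma path_fork_cycle x z p q :
    path sedge x p -> uniq (x :: p) -> path sedge x q -> uniq (x :: q) ->
    z \in p -> z \in q -> head x p != head x q ->
  exists2 c : seq T, (2 < size c)%N & ucycle sedge c.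
Proof.
move=> px up qx uq zp zq.
have hp : has (mem q) p by apply/hasP; exists z.
case/split_find: hp px up {zp zq z} => z p1 p2 zq np1 px up.
have {}zq : z \in q by [].
case/path.splitP: zq np1 qx uq => q1 q2 np1 qx uq hpq.
exists (x :: rcons p1 z ++ rev q1).
  rewrite /= size_cat size_rcons size_rev.
  by case: p1 q1 hpq {px up qx uq np1} => [|a p1] [|b q1] //=; rewrite eqxx.
move: px qx; rewrite !cat_path => /andP[p1z _] /andP[q1z _].
move: up uq; rewrite -!cat_cons !cat_uniq => /andP[up _] /andP[uq _].
apply/andP; split.
  rewrite /= rcons_cat -rev_cons cat_path p1z last_rcons.
  have := rev_path sedge x (rcons q1 z).
  rewrite last_rcons belast_rcons => ->.
  by rewrite (eq_path (e' := sedge)) // => a b; rewrite sedge_sym.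
rewrite cat_uniq up rev_uniq.
move: uq; rewrite /= rcons_uniq mem_rcons inE negb_or.
case/andP=> /andP[_ xq1] /andP[zq1 ->]; rewrite andbT.
apply/hasPn=> a; rewrite mem_rev => aq1.
rewrite inE mem_rcons inE negb_or; apply/andP; split.
  by apply: contraNneq xq1 => <-.
rewrite negb_or; apply/andP; split; first by apply: contraNneq zq1 => <-.
apply: contra np1 => ap1; apply/hasP; exists a => //=.
by rewrite mem_cat mem_rcons inE aq1 orbT.
Qed.

Hypothesis treeT : is_tree T.

Lemma simple_path_unique x y p q :
  simple_path x y p -> simple_path x y q -> p = q.
Proof.
have [_ _ acyc] := treeT.
elim: p x q => [|a p IHp] x [|b q] //.
- move=> /and3P[_ _ /eqP /= <-] /and3P[_ /= /andP[/negP nx _] /eqP eqx].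
  by case: nx; rewrite -{1}eqx mem_last.
- move=> /and3P[_ /= /andP[/negP nx _] /eqP eqx] /and3P[_ _ /eqP /= xy].
  by case: nx; rewrite {1}xy -eqx mem_last.
case: (eqVneq a b) => [<-|ab] /and3P[px up lp] /and3P[qx uq lq].
  congr (_ :: _); apply: (IHp a).
    by move: px up => /= /andP[_ pa] /andP[_ ua]; apply/and3P.
  by move: qx uq => /= /andP[_ pa] /andP[_ ua]; apply/and3P.
have yp : y \in a :: p by rewrite -(eqP lp) /= mem_last.
have yq : y \in b :: q by rewrite -(eqP lq) /= mem_last.
by have [c /acyc] := path_fork_cycle px up qx uq yp yq ab.
Qed.

Lemma simple_path_rev x y p :
  simple_path x y p -> simple_path y x (rev (belast x p)).
Proof.
case/and3P=> px up /eqP <-; apply/and3P; split.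
- by rewrite rev_path (eq_path (e' := sedge)) // => a b; rewrite sedge_sym.
- by rewrite -rev_rcons -lastI rev_uniq.
- by case: p {px up} => //= a p; rewrite rev_cons last_rcons.
Qed.

Lemma simple_path_exists x y : exists p, simple_path x y p.
Proof.
have [_ conn _] := treeT.
have /connectP[p px ->] := conn x y.
by case/shortenP: px => p' px up _; exists p'; apply/and3P.
Qed.

Variables (R : realType) (w : {set T} -> R).

(** Uniqueness lets any exhibited simple path replace the one chosen by [xget]. *)
Lemma wdist_simple_path x y p : simple_path x y p ->
  wdist w x y = \sum_(c <- pairmap (fun a b => w [set a; b]) x p) c.
Proof.
move=> xyp; rewrite /wdist /tree_path.
rewrite (@xget_unique _ _ _ p) // => q xyq.
exact: simple_path_unique xyq xyp.
Qed.

Lemma wdist_sym x y : wdist w x y = wdist w y x.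
Proof.
have [p xyp] := simple_path_exists x y.
rewrite (wdist_simple_path xyp) (wdist_simple_path (simple_path_rev xyp)).
have /and3P[_ _ /eqP <-] := xyp.
elim: p x {xyp} => [|a p IHp] x //=.
rewrite rev_cons -cats1 pairmap_cat big_cat /= big_cons big_seq1 IHp addrC.
congr (w _ + _).
by case: p {IHp} => [|b p] /=; rewrite ?rev_cons ?last_rcons finset.setUC.
Qed.

(** * Leaves hanging from a spine whose vertices have positions [A] *)

Section Spine.
Variables (s : nat -> T) (m : nat) (A : nat -> R).
Hypothesis s_edge : forall i, (i < m)%N -> sedge (s i) (s i.+1).
Hypothesis s_inj : forall i j, (i <= m)%N -> (j <= m)%N -> s i = s j -> i = j.
Hypothesis s_weight : forall i, (i < m)%N ->
  w [set s i; s i.+1] = A i.+1 - A i.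

Lemma spine_path k d : (k + d <= m)%N ->
  path sedge (s k) (map s (iota k.+1 d)).
Proof.
elim: d k => //= d IHd k kd; rewrite s_edge ?IHd //; lia.
Qed.

Lemma spine_weight k d : (k + d <= m)%N ->
  \sum_(c <- pairmap (fun a b => w [set a; b]) (s k) (map s (iota k.+1 d))) c
    = A (k + d)%N - A k.
Proof.
elim: d k => [|d IHd] k kd /=; first by rewrite big_nil addn0 subrr.
rewrite big_cons s_weight ?IHd; [|lia..].
by rewrite addSnnS; ring.
Qed.

(** The walk [u], [s k], ..., [s l], [v] is simple, and its spine weights telescope. This serves
    both the caterpillar and the reduced centipede. *)
Lemma wdist_spine u v k l :
    (k <= l)%N -> (l <= m)%N -> u != v ->
    (forall i, (i <= m)%N -> u != s i) -> (forall i, (i <= m)%N -> v != s i) ->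
    sedge u (s k) -> sedge v (s l) ->
  wdist w u v = w [set u; s k] + w [set v; s l] + (A l - A k).
Proof.
move=> kl lm uv us vs uk vl.
have lk : last (s k) [seq s i | i <- iota k.+1 (l - k)] = s l.
  by rewrite last_map -nth_last size_iota; case E: (l - k)%N => [|d] /=;
    [congr s; lia | rewrite (nth_iota _ (k.+1) (ltnSn d)); congr s; lia].
pose p := rcons (map s (iota k (l - k).+1)) v.
have uvp : simple_path u v p.
  apply/and3P; split.
  - rewrite /p rcons_path /= uk spine_path; last by lia.
    by rewrite lk sedge_sym.
  - rewrite cons_uniq rcons_uniq mem_rcons inE negb_or uv map_inj_in_uniq.
      rewrite iota_uniq andbT; apply/andP; split.
        by apply/mapP => -[i]; rewrite mem_iota => ki /eqP; apply/negP/us; lia.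
      by apply/mapP => -[i]; rewrite mem_iota => ki /eqP; apply/negP/vs; lia.
    by move=> i j; rewrite !mem_iota => ki kj; apply: s_inj; lia.
  - by rewrite last_rcons.
rewrite (wdist_simple_path uvp) /p -cats1 pairmap_cat big_cat /= big_cons.
rewrite big_seq1 lk spine_weight; last by lia.
by rewrite subnKC // (finset.setUC [set s l]); ring.
Qed.

End Spine.

End SimplePaths.

(** * Acyclicity, leaves of trees, and symmetric weights *)

(* A vertex of maximal rank on a cycle would have two such neighbours. *)
Lemma acyclic_of_rank (T : sgraph) (rk : T -> nat) :
    (forall x y z : T, sedge x y -> sedge x z ->
      (rk y <= rk x)%N -> (rk z <= rk x)%N -> y = z) ->
  forall p : seq T, (2 < size p)%N -> ~ ucycle sedge p.
Proof.
move=> rkP [|x0 p0] // szp; set p := x0 :: p0 in szp *.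
have px0 : x0 \in p by rewrite mem_head.
case: (@arg_maxnP _ x0 (mem p) rk px0) => x /= xp xmax cp.
have [i q rot_p] := rot_to xp.
have q_in y : y \in q -> (rk y <= rk x)%N.
  by move=> yq; apply: xmax; rewrite -[_ \in _](mem_rot i) rot_p inE yq orbT.
have szq : (1 < size q)%N.
  by rewrite -ltnS -[(size q).+1]/(size (x :: q)) -rot_p size_rot.
move: cp; rewrite -(rot_ucycle i) rot_p => /andP[] /=.
case/lastP: q szq q_in {rot_p} => [|[|y q] z] // _ q_in.
rewrite rcons_path last_rcons /= => /andP[/andP[xy _] zx].
case/and3P=> _ + _; rewrite mem_rcons inE negb_or => /andP[/eqP yz _].
apply: yz; apply: (rkP x) => //; first by rewrite sedge_sym.
  by apply: q_in; rewrite mem_head.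
by apply: q_in; rewrite inE mem_rcons mem_head orbT.
Qed.

(* Otherwise a simple path from [x] can be prolonged forever: its endpoint has a
   second neighbour, which by acyclicity is not on the path. *)
Lemma tree_other_leaf (T : sgraph) (x : T) : is_tree T -> is_leaf x ->
  exists2 y, is_leaf y & y != x.
Proof.
move=> [_ conn acyc] lx.
have [/existsP[y /andP[ly yx]]|] := boolP [exists y : T, is_leaf y && (y != x)].
  by exists y.
rewrite negb_exists => /forallP nleaf; exfalso.
have [z xz] : exists z : T, sedge x z.
  by move: lx => /eqP/eqP/cards1P[z /setP/(_ z)]; rewrite !inE eqxx; exists z.
suff grow k : exists p : seq T,
    [/\ size p = k.+1, path sedge x p & uniq (x :: p)].
  have [p [szp _ up]] := grow #|T|.
  have : (size (x :: p) <= #|T|)%N by rewrite -(card_uniqP up) max_card.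
  by rewrite /= szp ltnNge leqnSn.
elim: k => [|k [p [szp px up]]].
  exists [:: z]; split=> //=; first by rewrite xz.
  by rewrite inE andbT; apply: contraTneq xz => ->; rewrite sedge_irrefl.
case/lastP: p szp px up => // p e; rewrite size_rcons => -[szp] px up.
have ex : e != x.
  by move: up; rewrite /= mem_rcons inE negb_or eq_sym => /andP[/andP[]].
have /andP[pp pe] : path sedge x p && sedge (last x p) e by rewrite -rcons_path.
have [f ef fp] : exists2 f, sedge e f & f != last x p.
  have := nleaf e; rewrite ex andbT => /negP nle.
  have [/existsP[f /andP[]]|] :=
    boolP [exists f, sedge e f && (f != last x p)]; first by exists f.
  rewrite negb_exists => /forallP nf; case: nle.
  apply/cards1P; exists (last x p); apply/setP=> f; rewrite !inE.
  apply/idP/eqP => [ef|->]; last by rewrite sedge_sym.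
  by have := nf f; rewrite ef negbK => /eqP.
exists (rcons (rcons p e) f); rewrite !size_rcons szp; split=> //.
  by rewrite rcons_path px last_rcons.
rewrite -rcons_cons rcons_uniq up andbT -rcons_cons mem_rcons inE negb_or.
apply/andP; split; first by apply: contraTneq ef => ->; rewrite sedge_irrefl.
apply/negP => fxp.
move: px up fp; case/splitPl: fxp => p1 p2 fE px up fp.
(* The stretch from [f] to [e] closes up; [p2] is nonempty because [f] differs from the vertex
   preceding [e]. *)
apply: (acyc (f :: rcons p2 e)).
  rewrite /= size_rcons; case: p2 fp {px up} => //.
  by rewrite cats0 fE eqxx.
move: px up; rewrite rcons_cat cat_path fE => /andP[_ p2e].
rewrite -cat_cons lastI cat_rcons fE cat_uniq => /and3P[_ _ u2].
by apply/andP; split; rewrite // /cycle rcons_path p2e last_rcons.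
Qed.

(** The pair picked from [[set x; y]] is [(x, y)] or [(y, x)], and [f] agrees on both. *)
Lemma symmetric_set2_fun (V : finType) (R : nmodType) (f : V -> V -> R) :
    (forall x y, f x y = f y x) ->
  exists w : {set V} -> R, forall x y, w [set x; y] = f x y.
Proof.
move=> fC.
exists (fun S => if [pick a | S == [set a.1; a.2]] is Some a
                 then f a.1 a.2 else 0).
move=> x y; case: pickP => [[a b] /= /eqP E|/(_ (x, y))]; last by rewrite eqxx.
have: x \in [set a; b] by rewrite -E !inE eqxx.
have: y \in [set a; b] by rewrite -E !inE eqxx orbT.
have: a \in [set x; y] by rewrite E !inE eqxx.
have: b \in [set x; y] by rewrite E !inE eqxx orbT.
rewrite !inE => /orP[]/eqP-> /orP[]/eqP-> /orP[]/eqP E1 /orP[]/eqP E2;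
  by rewrite ?E1 ?E2 // ?E1 // fC.
Qed.

(** * The reduced centipede: tree structure, leaves and weights *)

Section ReducedCentipede.
Variable n : nat.
Let rc := reduced_centipede n.

(** The three clauses amount to clamping [i - 1] to the range from 0 to [n - 3]; the truncated
    predecessor takes care of the left end. *)
Lemma rc_legE (i : 'I_n) (j : 'I_(n - 3).+1) :
  rc_leg i j = (j == minn i.-1 (n - 3) :> nat).
Proof.
by have := ltn_ord i; have := ltn_ord j; rewrite /rc_leg; lia.
Qed.

Lemma rc_node_lt (i : 'I_n) : (minn i.-1 (n - 3) < (n - 3).+1)%N.
Proof. by rewrite ltnS geq_minr. Qed.

Lemma rc_edge_leaf (i : 'I_n) (x : rc) :
  sedge (inl i : rc) x = (x == inr (Ordinal (rc_node_lt i))).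
Proof. by case: x => [k|j] //=; rewrite rc_legE. Qed.

Lemma rc_is_tree : is_tree rc.
Proof.
split.
- by apply/card_gt0P; exists (inr ord0).
- have cs : connect_sym (@sedge rc).
    by apply: sym_connect_sym => x y; rewrite sedge_sym.
  have conr (j : 'I_(n - 3).+1) : connect sedge (inr ord0 : rc) (inr j).
    case: j => j; elim: j => [|j IHj] jn.
      by rewrite (_ : Ordinal jn = ord0) //; apply: val_inj.
    apply: connect_trans (IHj (ltnW jn)) _; apply: connect1 => /=.
    by rewrite eqxx.
  suff con x : connect sedge (inr ord0 : rc) x.
    by move=> x y; apply: connect_trans (con y); rewrite cs.
  case: x => [i|j]; last exact: conr.
  apply: connect_trans (conr (Ordinal (rc_node_lt i))) _.
  by apply: connect1; rewrite sedge_sym rc_edge_leaf.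
(* Leaves rank above all spine vertices, so the only neighbour of [inr j] of rank at most [j] is
   [inr j.-1]. *)
- apply: (@acyclic_of_rank rc (fun x => if x is inr j then val j else n)).
  case=> [i|j] y z; first by rewrite !rc_edge_leaf => /eqP-> /eqP->.
  have := ltn_ord j.
  case: y z => [i|k] [i'|k'] jn xy xz /= ky kz.
  + by have := ltn_ord i; lia.
  + by have := ltn_ord i; lia.
  + by have := ltn_ord i'; lia.
  + by congr inr; apply: val_inj; move: xy xz => /=; lia.
Qed.

(** For [n = 1] the tree is a single edge and its spine vertex would be a leaf too. For larger [n],
    [inr j] is adjacent to leaf [j.+1] and also to leaf 0 or to [inr j.-1]. *)
Lemma rc_is_leaf (x : rc) :
  n != 1%N -> is_leaf x = (if x is inl _ then true else false).
Proof.
move=> n1; case: x => [i|j].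
  apply/cards1P; exists (inr (Ordinal (rc_node_lt i))).
  by apply/setP => x; rewrite !inE rc_edge_leaf.
apply/negP => /cards1P[z zE].
have nbr (y : rc) : sedge (inr j : rc) y -> y = z.
  by move=> jy; apply/set1P; rewrite -zE inE.
have [n0|n_gt1] : n = 0%N \/ (1 < n)%N by lia.
  have : z \in [set y : rc | sedge (inr j : rc) y] by rewrite zE set11.
  rewrite inE; case: z {zE nbr} => [i|k] /=; first by have := ltn_ord i; lia.
  by have := ltn_ord j; have := ltn_ord k; lia.
have jn := ltn_ord j.
have j1n : (j.+1 < n)%N by lia.
have zr : inl (Ordinal j1n) = z by apply: nbr; rewrite /= /rc_leg /= eqxx.
have [j0|j_gt0] := posnP j.
  have n_gt0 : (0 < n)%N by lia.
  have : inl (Ordinal n_gt0) = z by apply: nbr; rewrite /= /rc_leg /=; lia.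
  by rewrite -zr => -[].
have j2n : (j.-1 < (n - 3).+1)%N by lia.
have : inr (Ordinal j2n) = z by apply: nbr => /=; lia.
by rewrite -zr.
Qed.

Lemma rc_card_leaf : n != 1%N -> #|{: {x : rc | is_leaf x}}| = n.
Proof.
move=> n1; rewrite card_sig -[RHS]card_ord.
rewrite -(card_imset predT (@inl_inj _ 'I_(n - 3).+1)).
apply: eq_card => x; rewrite inE rc_is_leaf //.
case: x => [i|j]; first by rewrite imset_f.
by symmetry; apply/negP => /imsetP[].
Qed.

Lemma rc_weight_exists (R : realType) (h p : nat -> R) :
    (forall i, (i < n)%N -> 0 < h i) ->
    (forall i j, (i < j)%N -> (j < n)%N -> p i < p j) ->
  exists2 w : {set rc} -> R, positive_weight w
    & forall i j : 'I_n, (i < j)%N ->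
        wdist w (inl i) (inl j) = h i + h j + (p j - p i).
Proof.
move=> h_gt0 p_lt.
(* [inr j] sits at position [p j.+1]; the absolute value vanishes except for the
   two extreme leaves. *)
pose leg (i j : nat) : R := h i + `|p i - p j.+1|.
pose f (x y : rc) : R := match x, y with
  | inl i, inr j => leg i j
  | inr j, inl i => leg i j
  | inr j, inr k => `|p j.+1 - p k.+1|
  | inl _, inl _ => 0
  end.
have [|w wE] := @symmetric_set2_fun rc R f.
  by case=> [i|j] [i'|j'] //=; apply: distrC.
have leg_gt0 (i : 'I_n) j : 0 < leg i j by rewrite ltr_wpDr ?h_gt0.
exists w.
  case=> [i|j] [i'|k] //= jk; rewrite wE //= normr_gt0 subr_eq0.
  have := ltn_ord j; have := ltn_ord k => kn jn.
  by have /orP[/eqP jk'|/eqP jk'] := jk; [rewrite lt_eqF|rewrite gt_eqF];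
    rewrite // p_lt //; lia.
have p_le i j : (i <= j)%N -> (j < n)%N -> p i <= p j.
  by rewrite leq_eqVlt => /predU1P[->|ij] jn; rewrite ?lexx // ltW ?p_lt.
move=> i j ij; have := ltn_ord i; have := ltn_ord j => jn i_n.
pose s k : rc := inr (inord k).
have legE (k : 'I_n) : w [set inl k; s (minn k.-1 (n - 3))] =
    leg k (minn k.-1 (n - 3)).
  by rewrite wE /= inordK // ltnS geq_minr.
have leaf_edge (k : 'I_n) : sedge (inl k : rc) (s (minn k.-1 (n - 3))).
  rewrite rc_edge_leaf; apply/eqP; congr inr; apply: val_inj => /=.
  by rewrite inordK // ltnS geq_minr.
rewrite (@wdist_spine rc rc_is_tree R w s (n - 3) (fun k => p k.+1) _ _ _
  (inl i) (inl j) _ _ _ _ _ _ _ (leaf_edge i) (leaf_edge j)) //.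
(* Since [i < j], leaf [i] is not the last and leaf [j] not the first: the spine vertex of [i] is
   not left of [p i], that of [j] not right of [p j]. This fixes both signs, and the sum collapses
   to [p j - p i]. *)
- rewrite !legE /leg ler0_norm; last by rewrite subr_le0 p_le //; lia.
  rewrite ger0_norm; last by rewrite subr_ge0 p_le //; lia.
  by ring.
- by move=> k kn; rewrite /= !inordK //; lia.
- move=> k l kn ln [/(congr1 val)]; rewrite /= !inordK //; lia.
- move=> k kn; rewrite wE /= !inordK //; [|lia..].
  by rewrite distrC ger0_norm // subr_ge0 p_le //; lia.
- lia.
- lia.
- by apply: contraTneq ij => -[->]; rewrite ltnn.
Qed.

End ReducedCentipede.

(** * Size of the perturbation and numbering of the leaves *)

Lemma finite_pos_lower_bound (R : realType) (I : finType) (F : I -> R) :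
  (forall i, 0 < F i) -> exists2 e : R, 0 < e & forall i, e < F i.
Proof.
move=> F_gt0; pose b := \big[Order.min/1]_i F i.
have b_gt0 : 0 < b by apply: lt_bigmin.
exists (b / 2); first by rewrite divr_gt0.
move=> i; have : b <= F i by apply: bigmin_le.
by move=> bi; lra.
Qed.

Lemma sorted_numbering (T : finType) (n : nat) (K : T -> nat) : #|T| = n ->
  exists (rho : T -> 'I_n) (x : 'I_n -> T),
    [/\ cancel rho x, cancel x rho
      & forall u v, (rho u <= rho v)%N -> (K u <= K v)%N].
Proof.
move=> Tn; pose leK u v := (K u <= K v)%N; pose s := sort leK (enum T).
have szs : size s = n by rewrite size_sort -cardE.
have us : uniq s by rewrite sort_uniq enum_uniq.
have s_all u : u \in s by rewrite mem_sort mem_enum.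
have rho_lt u : (index u s < n)%N by rewrite -szs index_mem.
pose rho u := Ordinal (rho_lt u).
have rho_inj : injective rho.
  by move=> u v [] uv; rewrite -(nth_index u (s_all u)) uv nth_index.
have [x rhoK xK] : bijective rho.
  by apply: inj_card_bij rho_inj _; rewrite card_ord Tn.
exists rho, x; split=> // u v.
apply: (@sorted_leq_index _ leK) => //.
- by move=> a b c; apply: leq_trans.
- by move=> a; apply: leqnn.
- by apply: sort_sorted => a b; apply: leq_total.
Qed.

Lemma mem_interval_shift (R : realType) (a b d e t : R) : 0 <= t -> t <= e ->
    e < (if d < a then a - d else if b < d then d - b else 1) ->
  a <= d + t <= b + e <-> a <= d <= b.
Proof.
move=> t_ge0 t_le; case: (ltP d a) => [da|ad]; last case: (ltP b d) => bd eb.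
- by move=> ea; split=> /andP[] // adt _; lra.
- by split=> /andP[] // _ dtb; lra.
- by split=> _; apply/andP; split; lra.
Qed.

Theorem theorem1 (R : realType) (n : nat) (G Gamma : sgraph)
    (w : {set Gamma} -> R) (dmin dmax : R)
    (G_card : #|G| = n)
    (Gamma_caterpillar : is_caterpillar Gamma n)
    (Gamma_deg : forall x : Gamma, degree x <> 2%N)
    (G_PCG : is_PCG G w dmin dmax) :
  exists (w' : {set reduced_centipede n} -> R) (dmax' : R),
    [/\ positive_weight w', dmin <= dmax' & is_PCG G w' dmin dmax'].

Proof.
have [treeT w_gt0 dmin_ge0 dmin_dmax [l l_bij lP]] := G_PCG.
have [_ leaves_n [x [p [px up sp]]]] := Gamma_caterpillar.
have n1 : n != 1%N.
  apply/eqP => n1; rewrite n1 in leaves_n.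
  have /eqP/cards1P[y yE] := leaves_n.
  have ly : is_leaf y by have := set11 y; rewrite -yE inE.
  have [z lz zy] := tree_other_leaf treeT ly.
  have : z \in [set y] by rewrite -yE inE.
  by rewrite inE (negbTE zy).
pose s := nth x (x :: p); pose m := size p.
pose K u := find (sedge (val (l u))) (x :: p).
pose A k := \sum_(0 <= i < k) w [set s i; s i.+1].
pose H u := w [set val (l u); s (K u)].
have s_edge i : (i < m)%N -> sedge (s i) (s i.+1) by move/(pathP x): px; apply.
have s_inj i j : (i <= m)%N -> (j <= m)%N -> s i = s j -> i = j.
  by move=> im jm /eqP; rewrite nth_uniq // => /eqP.
have s_in i : (i <= m)%N -> s i \in x :: p by move=> im; apply: mem_nth.
have hasK u : has (sedge (val (l u))) (x :: p).
  by have [_ [z zp lz]] := sp _ (valP (l u)); apply/hasP; exists z.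
have K_le u : (K u <= m)%N by rewrite -ltnS -[m.+1]/(size (x :: p)) -has_find.
have K_edge u : sedge (val (l u)) (s (K u)) by apply: nth_find.
have s_weight i : (i < m)%N -> w [set s i; s i.+1] = A i.+1 - A i.
  by move=> im; rewrite /A big_nat_recr //=; ring.
have A_le i j : (i <= j)%N -> (j <= m)%N -> A i <= A j.
  elim: j => [|j IHj]; first by rewrite leqn0 => /eqP->.
  rewrite leq_eqVlt => /predU1P[->//|ij] jm.
  apply: le_trans (IHj ij (ltnW jm)) _.
  by rewrite -subr_ge0 -s_weight // ltW // w_gt0 // s_edge.
have l_off u i : (i <= m)%N -> val (l u) != s i.
  move=> im; have [lu _] := sp _ (valP (l u)).
  by apply: contraNneq lu => ->; apply: s_in.
have distE u v : u != v -> (K u <= K v)%N ->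
    wdist w (val (l u)) (val (l v)) = H u + H v + (A (K v) - A (K u)).
  move=> uv Kuv; apply: (wdist_spine treeT s_edge s_inj s_weight) => //.
  - by rewrite (inj_eq val_inj) (inj_eq (bij_inj l_bij)).
  - exact: l_off.
  - exact: l_off.
have [rho [g [rhoK gK rhoP]]] := sorted_numbering K G_card.
pose d u v := wdist w (val (l u)) (val (l v)).
have [e e_gt0 eP] : exists2 e : R, 0 < e & forall a : G * G,
    e < if d a.1 a.2 < dmin then dmin - d a.1 a.2
        else if dmax < d a.1 a.2 then d a.1 a.2 - dmax else 1.
  apply: finite_pos_lower_bound => -[u v] /=.
  case: (ltP (d u v) dmin) => [|_]; first by rewrite subr_gt0.
  by case: (ltP dmax (d u v)) => [|_]; rewrite ?subr_gt0.
pose eps : R := e / n.+1%:R.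
have eps_gt0 : 0 < eps by rewrite divr_gt0.
pose h i := nth 0 [seq H (g j) | j <- enum 'I_n] i.
pose q i := A (nth 0%N [seq K (g j) | j <- enum 'I_n] i) + eps * i%:R.
have hE (i : 'I_n) : h i = H (g i).
  by rewrite /h (nth_map i) ?size_enum_ord // nth_ord_enum.
have qE (i : 'I_n) : q i = A (K (g i)) + eps * i%:R.
  by rewrite /q (nth_map i) ?size_enum_ord // nth_ord_enum.
have [||w' w'_gt0 w'E] := @rc_weight_exists n R h q.
- by move=> i i_n; rewrite (hE (Ordinal i_n)) w_gt0.
- move=> i j ij jn; have i_n := ltn_trans ij jn.
  rewrite (qE (Ordinal i_n)) (qE (Ordinal jn)) ler_ltD //=.
    by apply: A_le => //; apply: rhoP; rewrite !gK ltnW.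
  by rewrite ltr_pM2l // ltr_nat.
exists w', (dmax + e); split=> //; first by lra.
have leaf i : is_leaf (inl i : reduced_centipede n) by rewrite rc_is_leaf.
split=> //; [exact: rc_is_tree | by lra |].
exists (fun u => exist (fun y : reduced_centipede n => is_leaf y) _
  (leaf (rho u))).
  apply: inj_card_bij; last by rewrite rc_card_leaf // G_card.
  by move=> u v [/(congr1 val) /= ruv]; apply: (can_inj rhoK); apply: val_inj.
suff lt_case u v : (rho u < rho v)%N -> sedge u v <->
    dmin <= wdist w' (inl (rho u)) (inl (rho v)) <= dmax + e.
  move=> u v uv /=; have [uv'|vu|/val_inj E] := ltngtP (rho u) (rho v).
  - exact: lt_case.
  - by rewrite sedge_sym wdist_sym; [apply: lt_case | exact: rc_is_tree].
  - by rewrite (can_inj rhoK E) eqxx in uv.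
move=> uv; have u_v : u != v by apply: contraTneq uv => ->; rewrite ltnn.
have -> : wdist w' (inl (rho u)) (inl (rho v)) =
    d u v + eps * (rho v - rho u)%:R.
  rewrite w'E // !hE !qE !rhoK /d distE //; last by apply: rhoP; apply: ltnW.
  by rewrite natrB ?(ltnW uv) //; ring.
set t := eps * _.
have t_ge0 : 0 <= t by rewrite mulr_ge0 // ltW.
have t_le : t <= e.
  rewrite /t /eps mulrAC ler_pdivrMr // ler_pM2l // ler_nat.
  by have := ltn_ord (rho v); lia.
rewrite (lP u v u_v) -/(d u v).
exact: iff_sym (mem_interval_shift t_ge0 t_le (eP (u, v))).
Qed.
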